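(* Let $m$, $n$, and $s$ be positive integers, and let $G=\mathbb{Z}_n$ be the cyclic group of order $n$. 1. If $n=2m+1$, then the set $\{1,2,\dots,m\}$ is a perfect $1$-spanning set in $G$. 2. If $n=2s+1$, then the set $\{1\}$ is a perfect $s$-spanning set in $G$. 3. If $n=2s^2+2s+1$, then the set $\{s,s+1\}$ is a perfect $s$-spanning set in $G$.
   Context: The numbers $a(m,s)$, for non-negative integers $m,s$, are defined recursively by $a(m,0)=a(0,s)=1$ and, for $m,s\ge 1$, $a(m,s)=a(m-1,s)+a(m,s-1)+a(m-1,s-1)$. Let $G$ be a finite abelian group written additively and $A=\{a_1,\dots,a_m\}$ a subset of $G$ of size $m$. $A$ is an $s$-spanning set in $G$ if every $g\in G$ can be written as $g=\lambda_1a_1+\cdots+\lambda_m a_m$ for some integers $\lambda_1,\dots,\lambda_m$ with $|\lambda_1|+\cdots+|\lambda_m|\le s$. An $s$-spanning set $A$ of size $m$ in $G$ is called a perfect $s$-spanning set in $G$ if $|G|=a(m,s)$. Integers are regarded as elements of $\mathbb{Z}_n$ via reduction modulo $n$. *)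

(* Defs.v *)
From mathcomp Require Import all_boot all_order all_algebra.

Set Implicit Arguments.
Unset Strict Implicit.
Unset Printing Implicit Defensive.

Import GRing.Theory.
Local Open Scope ring_scope.

Fixpoint anum (m s : nat) {struct m} : nat :=
  match m with
  | 0 => 1
  | m'.+1 =>
    (fix anum_m (s : nat) : nat :=
       match s with
       | 0 => 1
       | s'.+1 => anum m' s'.+1 + anum_m s' + anum m' s'
       end) s
  end%N.

Lemma anum0s (s : nat) : anum 0 s = 1%N.
Proof. by []. Qed.

Lemma anumm0 (m : nat) : anum m 0 = 1%N.
Proof. by case: m. Qed.

Lemma anumSS (m s : nat) :
  anum m.+1 s.+1 = (anum m s.+1 + anum m.+1 s + anum m s)%N.
Proof. by []. Qed.

(* The coefficients are indexed by the elements of A themselves; the values of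
   lam outside A are irrelevant. *)
Definition spanning_set (G : finZmodType) (s : nat) (A : {set G}) : Prop :=
  forall g : G, exists lam : G -> int,
    g = \sum_(x in A) x *~ lam x /\ (\sum_(x in A) `|lam x| <= s)%N.

Definition perfect_spanning_set (G : finZmodType) (s : nat) (A : {set G}) :
    Prop :=
  spanning_set s A /\ #|G| = anum #|A| s.

Arguments spanning_set G s A : clear implicits.
Arguments perfect_spanning_set G s A : clear implicits.

(* Main.v *)
(** If [n = 2 k + 1], every element of [Z_n] is [+h] or [-h] for some integer
    [0 <= h <= k], and negating the coefficients of a combination does not
    change their total weight, so it suffices to represent [0, ..., k].  For
    [{s, s + 1}], where [k = s ^ 2 + s], one passes from a representation
    [h = x s + y (s + 1)] with [|x| + |y| <= s] to one of [h + 1] by moving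
    [(x, y)] by [(-1, 1)] or, if that leaves the ball of radius [s], by
    [(s, 1 - s)]; the second move fails only at [(0, s)], that is, at
    [h = s ^ 2 + s]. *)
Require Import Defs.
From mathcomp Require Import all_boot all_order all_algebra.
From mathcomp Require Import zify.
Set Implicit Arguments.
Unset Strict Implicit.
Unset Printing Implicit Defensive.

Import GRing.Theory.

Local Open Scope ring_scope.

Lemma anum1s (s : nat) : anum 1 s = (2 * s + 1)%N.
Proof. by elim: s => // s IH; rewrite anumSS IH !anum0s; lia. Qed.

Lemma anumm1 (m : nat) : anum m 1 = (2 * m + 1)%N.
Proof. by elim: m => // m IH; rewrite anumSS IH !anumm0; lia. Qed.

Lemma anum2s (s : nat) : anum 2 s = (2 * s ^ 2 + 2 * s + 1)%N.
Proof. by elim: s => // s IH; rewrite anumSS IH !anum1s; nia. Qed.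

Definition spans (G : finZmodType) (s : nat) (A : {set G}) (g : G) : Prop :=
  exists lam : G -> int,
    g = \sum_(x in A) x *~ lam x /\ (\sum_(x in A) `|lam x| <= s)%N.

Lemma spansN (G : finZmodType) (s : nat) (A : {set G}) (g : G) :
  spans s A g -> spans s A (- g).
Proof.
case=> lam [-> le_s]; exists (fun x => - lam x); split.
  by rewrite -sumrN; apply: eq_bigr => x _; rewrite mulrNz.
by under eq_bigr => x _ do rewrite abszN.
Qed.

Lemma spans0 (G : finZmodType) (s : nat) (A : {set G}) : spans s A 0.
Proof. by exists (fun=> 0); split; rewrite big1. Qed.

Lemma spans_mem (G : finZmodType) (A : {set G}) (g : G) :
  g \in A -> spans 1 A g.
Proof.
move=> gA; exists (fun x => (x == g)%:R); split.
  rewrite (bigD1 g) //= eqxx mulr1z big1 ?addr0 // => x /andP[_ /negPf->].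
  by rewrite mulr0z.
by rewrite (bigD1 g) //= eqxx big1 // => x /andP[_ /negPf->].
Qed.

Lemma spans1 (G : finZmodType) (s : nat) (a : G) (x : int) :
  (`|x| <= s)%N -> spans s [set a] (a *~ x).
Proof. by exists (fun=> x); rewrite !big_set1. Qed.

Lemma spans2 (G : finZmodType) (s : nat) (a b : G) (x y : int) :
  a != b -> (`|x| + `|y| <= s)%N -> spans s [set a; b] (a *~ x + b *~ y).
Proof.
move=> ab le_s; exists (fun z => if z == a then x else y).
have aNb : a \notin [set b] by rewrite inE.
by rewrite !big_setU1 //= !big_set1 eqxx eq_sym (negPf ab).
Qed.

Lemma spanning_Zodd (k n s : nat) (A : {set 'Z_n}) :
  (1 < n)%N -> n = (2 * k + 1)%N ->
  (forall h, (h <= k)%N -> spans s A h%:R) -> spanning_set 'Z_n s A.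
Proof.
move=> n1 nk spanA g; have ltgn : (g < n)%N by rewrite -[ltnRHS](Zp_cast n1).
have [le_gk|lt_kg] := leqP g k; first by rewrite -(natr_Zp g); exact: spanA.
(* Since [g > k], the representative [n - g] is at most [k]. *)
suff -> : g = - (n - g)%:R by apply/spansN/spanA; lia.
by rewrite natrB 1?ltnW // pchar_Zp // natr_Zp sub0r opprK.
Qed.

Lemma ball_rep (s h : nat) : (h <= s ^ 2 + s)%N ->
  exists x y : int, (`|x| + `|y| <= s)%N /\ x * s%:Z + y * (s + 1)%:Z = h%:Z.
Proof.
elim: h => [_|h IH lt_h]; first by exists 0, 0; split; [| lia].
have {IH}[x [y [le_s def_h]]] := IH (ltnW lt_h).
have [le_s'|gt_s] := leqP (`|x - 1| + `|y + 1|) s.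
  by exists (x - 1), (y + 1); split=> //; lia.
exists (x + s%:Z), (y + 1 - s%:Z); split; last by nia.
(* If [x > 0] or [y < 0], the move by [(-1, 1)] would not increase the weight. *)
have [xle0 yge0] : (x <= 0)%R /\ (0 <= y)%R by lia.
have : y <> s%:Z.
  move=> ys; have x0 : x = 0 by lia.
  move: def_h lt_h; rewrite x0 ys mul0r add0r -PoszM => -[<-].
  by rewrite mulnDr muln1 mulnn ltnn.
(* The failed first move gives [|x| + |y| >= s - 1]; as [y < s], the new weight is
   [2s - 1 - (|x| + |y|) <= s]. *)
lia.
Qed.

Theorem proposition5 (m n s : nat) (hm : (0 < m)%N) (hn : (0 < n)%N)
    (hs : (0 < s)%N) :
  (n = (2 * m + 1)%N ->
     perfect_spanning_set 'Z_n 1 [set (i.+1)%:R | i : 'I_m])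
  /\ (n = (2 * s + 1)%N ->
     perfect_spanning_set 'Z_n s [set 1])
  /\ (n = (2 * s ^ 2 + 2 * s + 1)%N ->
     perfect_spanning_set 'Z_n s [set s%:R; (s + 1)%:R]).
Proof.
(* ['Z_n] has order [n] only for [1 < n]; for smaller [n] it has order 2. *)
split; [|split] => def_n; have n1 : (1 < n)%N by lia.
- split; last first.
    rewrite card_imset ?card_ord ?Zp_cast ?anumm1 // => i j /(congr1 val).
    (* No reduction occurs, since [i + 1 <= m < n]. *)
    rewrite /= !val_Zp_nat // !modn_small; try by move: (ltn_ord i) (ltn_ord j); lia.
    by case=> /val_inj.
  apply: (spanning_Zodd n1 def_n) => -[|h] le_hm; first exact: spans0.
  by apply/spans_mem/imsetP; exists (Ordinal le_hm).
- split; last by rewrite card_ord Zp_cast // cards1 anum1s.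
  apply: (spanning_Zodd n1 def_n) => h le_hs.
  exact: (@spans1 _ _ 1 h%:Z).
(* The difference is [1], nonzero in ['Z_n]. Hence the set has two elements, whose coefficients can
   be chosen independently. *)
- have neq_s : s%:R != (s + 1)%:R :> 'Z_n.
    by rewrite natrD -subr_eq0 opprD addNKr oppr_eq0 oner_eq0.
  split; last by rewrite card_ord Zp_cast // cards2 neq_s anum2s.
  apply: (@spanning_Zodd (s ^ 2 + s)) => // [|h le_h]; first by lia.
  have [x [y [le_s def_h]]] := ball_rep le_h.
  have -> : h%:R = s%:R *~ x + (s + 1)%:R *~ y :> 'Z_n.
    rewrite (pmulrn 1 h) -def_h mulrzDr [x * _]mulrC [y * _]mulrC.
    by rewrite !mulrzA -!pmulrn.
  exact: spans2.
Qed.
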